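(* Let $\mathbb{F}$ be a finite field with $|\mathbb{F}|=Q$ and let $d\ge1$, $n\ge 0$. Let $a_1,\dots,a_n$ be independent uniformly distributed random vectors in $\mathbb{F}^d$, let $A_n\in\mathbb{F}^{n\times d}$ be the matrix with rows $a_1^\top,\dots,a_n^\top$, and let outputs be generated by a fixed latent parameter $w^\ast\in\mathbb{F}^d$ through $b_i=(w^\ast)^\top a_i$. Let $W_n=\{w\in\mathbb{F}^d: w^\top a_i=b_i \text{ for } 1\le i\le n\}$. Then full semantic identification (the event that $W_n$ is a singleton) occurs exactly when $A_n$ has rank $d$, and \[ \mathbb{P}(\operatorname{rank}(A_n)=d)=\begin{cases}0,& n<d,\\ \displaystyle\prod_{i=0}^{d-1}\bigl(1-Q^{i-n}\bigr),& n\ge d.\end{cases} \] Consequently, the probability that every query $q\in\mathbb{F}^d$ is semantically determined after $n$ random examples is given by the same expression.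
   Context: A query $q\in\mathbb{F}^d$ is semantically determined if $w^\top q$ takes the same value for all $w\in W_n$. *)

(* Defs.v *)
From HB Require Import structures.
From mathcomp Require Import all_boot all_order all_algebra.
From mathcomp Require Import all_classical all_reals all_analysis.

Set Implicit Arguments.
Unset Strict Implicit.
Unset Printing Implicit Defensive.
Import Order.TTheory GRing.Theory Num.Theory.
Local Open Scope classical_set_scope.
Local Open Scope ring_scope.

(* F^d, as column vectors, equipped with the discrete sigma-algebra, so that
   {RV P >-> vec F d} is the type of random vectors in F^d. *)
Definition vec (F : finFieldType) (d : nat) : Type := 'cV[F]_d.

HB.instance Definition _ (F : finFieldType) (d : nat) :=
  GRing.Zmodule.on (vec F d).
HB.instance Definition _ (F : finFieldType) (d : nat) :=
  Finite.on (vec F d).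
HB.instance Definition _ (F : finFieldType) (d : nat) :=
  isPointed.Build (vec F d) (0 : 'cV[F]_d).
HB.instance Definition _ (F : finFieldType) (d : nat) :=
  @isMeasurable.Build default_measure_display (vec F d)
    discrete_measurable discrete_measurable0
    discrete_measurableC discrete_measurableU.

Section probability_notions.
Context {disp : measure_display} {T : measurableType disp} {R : realType}.
Variable P : probability T R.

Definition mutually_independent {disp' : measure_display}
    {T' : measurableType disp'} {I : finType} (X : I -> {RV P >-> T'}) : Prop :=
  forall (J : {set I}) (B : I -> set T'),
    (forall i, measurable (B i)) ->
    P (\bigcap_(i in [set` J]) (X i @^-1` B i)) =
    (\prod_(i in J) P (X i @^-1` B i))%E.

Definition uniformly_distributed (F : finFieldType) (d : nat)
    (X : {RV P >-> vec F d}) : Prop :=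
  forall v : vec F d, distribution P X [set v] = (#|{: vec F d}|%:R^-1)%:E.

End probability_notions.

Section version_space.
Variables (F : finFieldType) (d : nat).

Definition dotv (w q : vec F d) : F := ((w : 'cV[F]_d)^T *m q) 0 0.

Definition example_matrix (n : nat) (a : 'I_n -> vec F d) : 'M[F]_(n, d) :=
  \matrix_(i < n) (a i : 'cV[F]_d)^T.

Definition version_space (n : nat) (a : 'I_n -> vec F d) (b : 'I_n -> F) :
    set (vec F d) :=
  [set w | forall i, dotv w (a i) = b i].

Definition is_singleton (W : set (vec F d)) : Prop := exists w, W = [set w].

Definition semantically_determined (W : set (vec F d)) (q : vec F d) : Prop :=
  forall w w', W w -> W w' -> dotv w q = dotv w' q.

End version_space.

Definition full_rank_probability (R : realType) (Q d n : nat) : R :=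
  if (n < d)%N then 0
  else \prod_(i < d) (1 - (Q%:R : R) ^ (i%:Z - n%:Z)).

(* Main.v *)
(** Transposing, [A_n] has rank [d] iff the [d] rows of its transpose in [F^n]
    are linearly independent. Choosing independent rows one at a time, a new
    row must avoid the [Q^i] combinations of the [i] rows already chosen, so
    there are [\prod_(i < d) (Q^n - Q^i)] such matrices; when [n < d] the factor
    [i = n] vanishes. As [A_n] is uniform among the [Q^(n d)] matrices, dividing
    gives the probability. Finally [W_n] is the coset of [w*] modulo the kernel
    of [A_n], so it is a singleton iff that kernel is trivial. *)
Require Import Defs.
From mathcomp Require Import all_boot all_order all_algebra.
From mathcomp Require Import all_classical all_reals all_analysis.
Set Implicit Arguments.
Unset Strict Implicit.
Unset Printing Implicit Defensive.
Import Order.TTheory GRing.Theory Num.Theory.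
Local Open Scope classical_set_scope.
Local Open Scope ring_scope.

(** * Counting matrices of full rank over a finite field *)

Section counting.
Variable F : finFieldType.

(** Freeness makes [u *m A] injective in [u], and its image is the row space. *)
Lemma card_rowspace_free m n (A : 'M[F]_(m, n)) :
  row_free A -> #|[pred v : 'rV[F]_n | (v <= A)%MS]| = (#|F| ^ m)%N.
Proof.
move=> freeA; rewrite -[m in RHS]mul1n -card_mx.
rewrite -(card_imset predT (@row_free_inj _ 1 _ _ _ freeA)).
apply: eq_card => v; rewrite inE.
by apply/submxP/imsetP => [[u ->]|[u _ ->]]; exists u.
Qed.

Lemma row_free_col_mx m n (v : 'rV[F]_n) (A : 'M[F]_(m, n)) :
  row_free (col_mx v A) = row_free A && ~~ (v <= A)%MS.
Proof.
apply/idP/andP => [free_vA|[freeA vA]].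
  have inj := row_free_inj free_vA; split.
    apply: inj_row_free => u uA0.
    have : row_mx (0 : 'rV_1) u = 0.
      by apply: (inj 1%N); rewrite mul_row_col mul0mx uA0 add0r mul0mx.
    by rewrite -[RHS]row_mx0 => /eq_row_mx[].
  apply/negP => /submxP[u vE].
  (* With [v = u *m A], the coefficients [(1, -u)] form a nontrivial relation between the rows. *)
  have : row_mx (1%:M : 'rV_1) (- u) = 0.
    by apply: (inj 1%N); rewrite mul_row_col mul1mx mulNmx vE subrr mul0mx.
  rewrite -[RHS]row_mx0 => /eq_row_mx[/matrixP/(_ 0 0)/eqP].
  by rewrite !mxE eqxx oner_eq0.
apply: inj_row_free => u; rewrite -[u]hsubmxK mul_row_col.
set c := lsubmx u; set w := rsubmx u => cvwA.
(* If the coefficient of [v] in the relation is nonzero, solving for [v] puts it in the row space of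
   [A]. *)
have [c0|c_neq0] := eqVneq (c 0 0) 0; last first.
  case/negP: vA; rewrite -(eqmx_scale v c_neq0) -mul_scalar_mx -mx11_scalar.
  by move/eqP: cvwA; rewrite addr_eq0 => /eqP->; rewrite -mulNmx submxMl.
have {}c0 : c = 0 by rewrite [c]mx11_scalar c0 raddf0.
move: cvwA; rewrite c0 mul0mx add0r -(mul0mx 1 A) => /(row_free_inj freeA)->.
by rewrite row_mx0.
Qed.

(* The subtraction is truncated; for [n < m] both sides are 0. *)
Lemma card_row_free m n :
  #|[pred A : 'M[F]_(m, n) | row_free A]| =
  (\prod_(i < m) (#|F| ^ n - #|F| ^ i))%N.
Proof.
elim: m => [|m IHm].
  rewrite big_ord0 -[RHS](card_mx F 0 n); apply: eq_card => A.
  by rewrite !inE; apply: inj_row_free => u _; apply: thinmx0.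
rewrite big_ord_recr /= -IHm -sum_nat_const -sum1_card -add1n.
(* Split off the top row [p.1]; the induction hypothesis covers the block [p.2] below it. *)
rewrite (reindex (fun p : 'rV[F]_n * 'M[F]_(m, n) => col_mx p.1 p.2)) /=; last first.
  exists (fun A : 'M[F]_(1 + m, n) => (usubmx A, dsubmx A)) => [[v A] _|A _] /=.
    by rewrite col_mxKu col_mxKd.
  by rewrite vsubmxK.
under eq_bigl do rewrite inE row_free_col_mx andbC.
rewrite (eq_bigl (fun p : 'rV[F]_n * 'M[F]_(m, n) =>
  predT p.1 && (row_free p.2 && ~~ (p.1 <= p.2)%MS))); last first.
  by move=> p; rewrite andbC.
rewrite -(pair_big_dep xpredT (fun v A => row_free A && ~~ (v <= A)%MS)
  (fun _ _ => 1%N)) /=.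
(* With [A] summed outermost, it remains to count, for each free [A], the rows outside its row
   space. *)
rewrite (exchange_big_dep (fun A : 'M[F]_(m, n) => row_free A)) /=; last first.
  by move=> v A _ /andP[].
apply: eq_bigr => A freeA.
rewrite (eq_bigl (predC [pred v : 'rV[F]_n | (v <= A)%MS])); last first.
  by move=> v; rewrite freeA.
rewrite sum1_card -(card_rowspace_free freeA) -[n in (_ ^ n)%N]mul1n.
by rewrite -card_mx -(cardC [pred v : 'rV[F]_n | (v <= A)%MS]) addKn.
Qed.

(** Bridge from rank [d] to a trivial kernel on column vectors, where differences of parameters
    live. *)
Lemma row_free_trP n d (A : 'M[F]_(n, d)) :
  reflect (forall v : 'cV_d, A *m v = 0 -> v = 0) (row_free A^T).
Proof.
apply: (iffP idP) => [freeA v Av0|Ainj].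
  apply: trmx_inj; apply: (row_free_inj freeA).
  by rewrite -trmx_mul Av0 !trmx0 mul0mx.
apply: inj_row_free => v vA0; apply: trmx_inj; rewrite trmx0.
by apply: Ainj; rewrite -[A]trmxK -trmx_mul vA0 trmx0.
Qed.

Lemma card_full_rank n d :
  #|[pred A : 'M[F]_(n, d) | \rank A == d]| =
  (\prod_(i < d) (#|F| ^ n - #|F| ^ i))%N.
Proof.
rewrite -card_row_free -(card_imset _ (@trmx_inj F n d)).
apply: eq_card => A; rewrite !inE; apply/imsetP/idP => [[B + ->]|freeA].
  by rewrite inE /row_free mxrank_tr.
by exists A^T; rewrite ?trmxK // inE mxrank_tr.
Qed.

Lemma card_full_rank_ratio (R : realType) n d :
  (#|[pred A : 'M[F]_(n, d) | \rank A == d]|%:R / (#|F| ^ (n * d))%:R : R) =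
  full_rank_probability R #|F| d n.
Proof.
have Q0 : (#|F|%:R : R) != 0.
  by rewrite pnatr_eq0 -lt0n; apply/card_gt0P; exists 0.
rewrite card_full_rank /full_rank_probability; case: ltnP => [ltnd|lend].
  by rewrite (bigD1 (Ordinal ltnd)) //= subnn mul0n mul0r.
(* The denominator becomes a product over [i < d], so that the division can be done factor by
   factor. *)
have prod_Qn : \prod_(i < d) (#|F| ^ n)%:R = (#|F| ^ n)%:R ^+ d :> R.
  by rewrite prodr_const card_ord.
rewrite expnM natrX -prod_Qn natr_prod -prodf_div.
apply: eq_bigr => i _.
(* This bound makes the truncated subtraction agree with subtraction in [R]. *)
have lein : (i <= n)%N by rewrite ltnW // (leq_trans _ lend).
have Qn : (0 < #|F|)%N by apply/card_gt0P; exists 0.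
rewrite natrB ?leq_pexp2l // !natrX expfzDr // -exprnN -exprnP mulrBl.
by rewrite divff // expf_neq0.
Qed.

End counting.

(** * Linear algebra of the version space for a fixed sample *)

Section version_space.
Variables (F : finFieldType) (d n : nat) (a : 'I_n -> vec F d).

Lemma mul_example_matrix (w : vec F d) i :
  (example_matrix a *m (w : 'cV[F]_d)) i 0 = dotv w (a i).
Proof. by rewrite /dotv !mxE; apply: eq_bigr => j _; rewrite !mxE mulrC. Qed.

Lemma version_spaceP (wstar w : vec F d) :
  version_space a (fun i => dotv wstar (a i)) w <->
  example_matrix a *m (w - wstar : 'cV[F]_d) = 0.
Proof.
rewrite mulmxBr; split => [Ww|/eqP].
  apply/eqP; rewrite subr_eq0; apply/eqP/matrixP => i j.
  by rewrite ord1 !mul_example_matrix.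
rewrite subr_eq0 => /eqP/matrixP eq_w i.
by have := eq_w i 0; rewrite !mul_example_matrix.
Qed.

(** Queries at the standard basis vectors read off the coordinates. *)
Lemma dotv_inj (w w' : vec F d) : (forall q, dotv w q = dotv w' q) -> w = w'.
Proof.
move=> eq_ww'; apply/matrixP => i j; rewrite ord1.
have dotE (u : vec F d) : dotv u (delta_mx i 0 : 'cV_d) = u i 0.
  by rewrite /dotv -colE !mxE.
by rewrite -!dotE.
Qed.

(** Since [wstar] lies in [W], determined queries force every member of [W] to agree with [wstar] on
    all queries. *)
Lemma all_determinedP (wstar : vec F d) :
  let W := version_space a (fun i => dotv wstar (a i)) in
  (forall q, semantically_determined W q) <-> is_singleton W.
Proof.
move=> W; split => [det|[w0 ->] q w w' -> -> //].
exists wstar; apply/seteqP; split => [w Ww|w -> //] /=.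
by apply: dotv_inj => q; apply: det.
Qed.

Lemma singleton_version_spaceP (wstar : vec F d) :
  is_singleton (version_space a (fun i => dotv wstar (a i))) <->
  \rank (example_matrix a) = d.
Proof.
set W := version_space _ _.
have <- : row_free (example_matrix a)^T <-> \rank (example_matrix a) = d.
  by rewrite /row_free mxrank_tr; split => /eqP.
split => [[w0 WE]|/row_free_trP Ainj].
  apply/row_free_trP => v Av0.
  (* Translating [wstar] by a kernel vector stays in [W]; using this for both [v] and [0] gives
     [wstar + v = wstar]. *)
  have in_W (u : vec F d) : example_matrix a *m (u : 'cV[F]_d) = 0 ->
      (wstar + u : vec F d) = w0.
    move=> Au0; have : W (wstar + u) by apply/version_spaceP; rewrite addrC addKr.
    by rewrite WE.
  apply: (@addrI _ (wstar : 'cV[F]_d)); rewrite addr0.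
  by rewrite [LHS]in_W // -[RHS]addr0 [RHS]in_W // mulmx0.
exists wstar; apply/seteqP; split => [w /version_spaceP/Ainj/eqP|w -> //].
by rewrite subr_eq0 => /eqP.
Qed.

End version_space.

(** * Distribution of the random example matrix *)

Section uniform_sample.
Variables (F : finFieldType) (d n : nat).
Context {disp : measure_display} {T : measurableType disp} {R : realType}.
Variables (P : probability T R) (a : 'I_n -> {RV P >-> vec F d}).
Hypothesis a_indep : mutually_independent a.
Hypothesis a_unif : forall i, uniformly_distributed (a i).

Let A (t : T) : 'M[F]_(n, d) := example_matrix (fun i => a i t).

(** The intersection over the full index set is the form to which [mutually_independent] applies. *)
Lemma example_matrix_preimage (M : 'M[F]_(n, d)) :
  A @^-1` [set M] = \bigcap_(i in [set` [set: 'I_n]%SET])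
    (a i @^-1` [set (row i M)^T : vec F d]).
Proof.
apply/seteqP; split => [t <- i _|t aM] /=.
  by rewrite rowK trmxK.
apply/row_matrixP => i; rewrite rowK.
have -> : a i t = (row i M)^T by apply: aM; rewrite /= finset.in_setT.
by rewrite trmxK.
Qed.

Lemma measurable_example_matrix (M : 'M[F]_(n, d)) :
  measurable (A @^-1` [set M]).
Proof.
rewrite example_matrix_preimage; apply: fin_bigcap_measurable => // i _.
by rewrite -[X in measurable X]setTI; apply: measurable_funP.
Qed.

(** By independence the [n] rows contribute separately, each with the inverse of [#|F| ^ d] by
    uniformity. *)
Lemma probability_example_matrix1 (M : 'M[F]_(n, d)) :
  P (A @^-1` [set M]) = ((#|F| ^ (n * d))%:R^-1)%:E.
Proof.
rewrite example_matrix_preimage a_indep //.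
rewrite (eq_bigr (fun=> ((#|F| ^ d)%:R^-1)%:E)); last first.
  by move=> i _; have := a_unif i (row i M)^T; rewrite card_mx muln1.
rewrite prodEFin prodr_const cardsT card_ord exprVn -natrX -expnM.
by rewrite mulnC.
Qed.

(** Finite additivity over the disjoint fibres of [A] above [S], all of equal mass. *)
Lemma probability_example_matrix (S : pred 'M[F]_(n, d)) :
  P [set t | S (A t)] = (#|S|%:R / (#|F| ^ (n * d))%:R)%:E.
Proof.
have -> : [set t | S (A t)] = \bigcup_(M in [set` S]) (A @^-1` [set M]).
  by apply/seteqP; split => [t St|t [M SM /= ->] //]; exists (A t).
rewrite measure_fin_bigcup //; first last.
- by move=> M _; apply: measurable_example_matrix.
- by move=> M M' _ _ [t [<- <-]].
rewrite (eq_fsbigr (fun=> ((#|F| ^ (n * d))%:R^-1)%:E)); last first.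
  by move=> M _; apply: probability_example_matrix1.
rewrite (@fsbigE _ _ _ _ _ (enum S)) ?enum_uniq //; first last.
- by move=> M SM; rewrite mem_enum => /negP[].
- by move=> M /=; rewrite mem_enum.
rewrite big_enum_cond /= sumEFin; congr (_%:E).
rewrite (eq_bigl (mem S)) ?sumr_const ?mulr_natl // => M.
by rewrite andb_idr // => SM; rewrite inE.
Qed.

End uniform_sample.

Theorem theorem5p4 (F : finFieldType) (Q : nat) (hQ : #|F| = Q)
    (d n : nat) (hd : (1 <= d)%N)
    (disp : measure_display) (T : measurableType disp) (R : realType)
    (P : probability T R)
    (a : 'I_n -> {RV P >-> vec F d})
    (a_indep : mutually_independent a)
    (a_unif : forall i, uniformly_distributed (a i))
    (wstar : vec F d) :
  let A (t : T) : 'M[F]_(n, d) := example_matrix (fun i => a i t) in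
  let b (t : T) (i : 'I_n) : F := dotv wstar (a i t) in
  let W (t : T) : set (vec F d) := version_space (fun i => a i t) (b t) in
  [/\ [set t | is_singleton (W t)] = [set t | \rank (A t) = d],
      P [set t | \rank (A t) = d] = (full_rank_probability R Q d n)%:E
    & P [set t | forall q : vec F d, semantically_determined (W t) q] =
      (full_rank_probability R Q d n)%:E].
Proof.
move=> A b W.
have singletonE : [set t | is_singleton (W t)] = [set t | \rank (A t) = d].
  apply/seteqP; split => t.
    by move/(singleton_version_spaceP (fun i => a i t) wstar).
  by move/(singleton_version_spaceP (fun i => a i t) wstar).
have rankP : P [set t | \rank (A t) = d] = (full_rank_probability R Q d n)%:E.
  rewrite -hQ -card_full_rank_ratio -(probability_example_matrix a_indep a_unif).
  by congr (P _); apply/seteqP; split => t /eqP.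
(* The third event coincides with the singleton event outcome by outcome, hence with the rank
   event. *)
split=> //; rewrite -rankP -singletonE; congr (P _).
apply/seteqP; split => t.
  by move/(all_determinedP (fun i => a i t) wstar).
by move/(all_determinedP (fun i => a i t) wstar).
Qed.
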